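(* Let $f:S\to T$ be an se-homomorphism between semigroups with apartness. Then: (i) $\mathrm{coker}\,f$ is a co-congruence on $S$; (ii) $\mathrm{coker}\,f\looparrowleft\ker f$ and $\ker f\subseteq(\mathrm{coker}\,f)^c$; (iii) $(S/\ker f,=,\#,\cdot)$ is a semigroup with apartness, where $a(\ker f)=b(\ker f)\iff(a,b)\in\ker f$, $a(\ker f)\#b(\ker f)\iff(a,b)\in\mathrm{coker}\,f$, and $a(\ker f)\cdot b(\ker f)=(ab)(\ker f)$; (iv) the mapping $\varphi:S/\ker f\to T$, $\varphi(x(\ker f))=f(x)$, is an apartness embedding with $f=\varphi\pi$, where $\pi(x)=x(\ker f)$; (v) if $f$ maps $S$ onto $T$, then $\varphi$ is an apartness isomorphism.
   Context: Constructive (Bishop-style) setting. A set with apartness: inhabited set with equality $=$ (an equivalence) and $\#$ with $\neg(x\#x)$, $x\#y\Rightarrow y\#x$, $x\#z\Rightarrow\forall y(x\#y\vee y\#z)$, extensional w.r.t. $=$; $S\times S$ has apartness $(s,t)\#(u,v)\iff s\#u\vee t\#v$. A semigroup with apartness is a set with apartness with an associative operation satisfying $ax\#by\Rightarrow(a\#b\vee x\#y)$. An se-homomorphism is a homomorphism $f$ with $f(x)\#f(y)\Rightarrow x\#y$; $f$ is a-injective if $x\#y\Rightarrow f(x)\#f(y)$. An apartness embedding is an a-injective injective se-homomorphism; an apartness isomorphism is an a-injective bijective se-homomorphism. $\ker f=\{(x,y):f(x)=f(y)\}$, $\mathrm{coker}\,f=\{(x,y):f(x)\#f(y)\}$. A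 co-congruence is a relation $\kappa$ that is symmetric, strongly irreflexive ($(x,y)\in\kappa\Rightarrow x\#y$), co-transitive ($(x,y)\in\kappa\Rightarrow\forall z((x,z)\in\kappa\vee(z,y)\in\kappa)$) and co-compatible ($(xz,yt)\in\kappa\Rightarrow(x,y)\in\kappa\vee(z,t)\in\kappa$). For such $\kappa$, $\kappa^c=\{(x,y):\forall(a,b)\in\kappa\,((x,y)\#(a,b))\}$. $\alpha\looparrowleft\beta$ means $(x,y)\in\alpha\wedge(y,z)\in\beta\Rightarrow(x,z)\in\alpha$. *)

(* Defs.v *)
From Stdlib Require Import Relations RelationClasses Morphisms.

Set Implicit Arguments.
Unset Strict Implicit.

Declare Scope apart_scope.
Delimit Scope apart_scope with ap.

(* Bishop-style: a set is a type together with its equality, which is not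
   assumed to be Leibniz equality, and the apartness is not assumed tight.
   Carriers with operations ([..._data]) are separated from their axioms so
   that "this data is a semigroup with apartness" can be asserted. *)

Record apset_data := ApsetData {
  carrier :> Type;
  eqv : relation carrier;
  apart : relation carrier
}.

Record semigroup_data := SemigroupData {
  apset_of :> apset_data;
  mul : apset_of -> apset_of -> apset_of
}.

Notation "x == y" := (eqv x y) (at level 70, no associativity) : apart_scope.
Notation "x # y" := (apart x y) (at level 70, no associativity) : apart_scope.
Notation "x * y" := (mul x y) : apart_scope.

Local Open Scope apart_scope.

Record set_with_apartness (S : apset_data) : Prop := {
  apset_inhabited : inhabited S;
  apset_eqv_equiv : Equivalence (@eqv S);
  apart_irrefl : forall x : S, ~ x # x;
  apart_sym : forall x y : S, x # y -> y # x;
  apart_cotrans : forall x z : S, x # z -> forall y : S, x # y \/ y # z;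
  apart_ext : Proper (@eqv S ==> @eqv S ==> iff) (@apart S)
}.

Definition prod_apset (S T : apset_data) : apset_data := {|
  carrier := (S * T)%type;
  eqv := fun p q => fst p == fst q /\ snd p == snd q;
  apart := fun p q => fst p # fst q \/ snd p # snd q
|}.

(* [mul_ext] says that the multiplication is a function for the given
   equality. *)
Record semigroup_with_apartness (S : semigroup_data) : Prop := {
  semigroup_apset : set_with_apartness S;
  mul_ext : Proper (@eqv S ==> @eqv S ==> @eqv S) (@mul S);
  mul_assoc : forall x y z : S, (x * y) * z == x * (y * z);
  mul_strong_ext : forall a b x y : S, a * x # b * y -> a # b \/ x # y
}.

Section Maps.
Variables S T : apset_data.
Implicit Type f : S -> T.

(* Being a function for the given equalities; since the apartness is not
   tight, this does not follow from [strongly_extensional]. *)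
Definition is_mapping f : Prop := Proper (@eqv S ==> @eqv T) f.
Definition strongly_extensional f : Prop := forall x y, f x # f y -> x # y.
Definition injective f : Prop := forall x y, f x == f y -> x == y.
Definition a_injective f : Prop := forall x y, x # y -> f x # f y.
Definition onto f : Prop := forall t : T, exists x : S, f x == t.
Definition bijective f : Prop := injective f /\ onto f.

Definition ker f : relation S := fun x y => f x == f y.
Definition coker f : relation S := fun x y => f x # f y.
End Maps.

Section Homomorphisms.
Variables S T : semigroup_data.
Implicit Type f : S -> T.

Definition homomorphism f : Prop :=
  is_mapping f /\ forall x y : S, f (x * y) == f x * f y.
Definition se_homomorphism f : Prop :=
  homomorphism f /\ strongly_extensional f.
Definition apartness_embedding f : Prop :=
  se_homomorphism f /\ injective f /\ a_injective f.
Definition apartness_isomorphism f : Prop :=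
  se_homomorphism f /\ bijective f /\ a_injective f.
End Homomorphisms.

(* Extensionality of [k] with respect to [==] need not be required: it follows
   from [cc_sym], [cc_strong_irrefl] and [cc_cotrans]. *)
Record co_congruence (S : semigroup_data) (k : relation S) : Prop := {
  cc_sym : forall x y : S, k x y -> k y x;
  cc_strong_irrefl : forall x y : S, k x y -> x # y;
  cc_cotrans : forall x y : S, k x y -> forall z : S, k x z \/ k z y;
  cc_cocompat : forall x y z t : S, k (x * z) (y * t) -> k x y \/ k z t
}.

Definition a_complement (S : apset_data) (k : relation S) : relation S :=
  fun x y => forall a b : S, k a b -> @apart (prod_apset S S) (x, y) (a, b).

Definition left_associated (S : apset_data) (alpha beta : relation S) : Prop :=
  forall x y z : S, alpha x y /\ beta y z -> alpha x z.

(* As usual in Bishop-style mathematics, a class of the quotient is given by a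
   representative, [qclass e x] being the class of [x] modulo [e]; it is the
   equality on the quotient that identifies representatives related by [e]. *)
Record quotient_type (A : Type) (e : relation A) := QClass { repr : A }.
Definition qclass (A : Type) (e : relation A) (x : A) : quotient_type e :=
  QClass e x.

Definition quotient (S : semigroup_data) (e k : relation S) : semigroup_data := {|
  apset_of := {|
    carrier := quotient_type e;
    eqv := fun a b => e (repr a) (repr b);
    apart := fun a b => k (repr a) (repr b)
  |};
  mul := fun a b => qclass e (repr a * repr b)
|}.

Definition ker_quotient (S T : semigroup_data) (f : S -> T) : semigroup_data :=
  quotient (ker f) (coker f).

Definition proj (S T : semigroup_data) (f : S -> T) : S -> ker_quotient f :=
  fun x => qclass (ker f) x.

Definition induced (S T : semigroup_data) (f : S -> T) : ker_quotient f -> T :=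
  fun a => f (repr a).

Arguments proj {S T} f _.
Arguments induced {S T} f _.

(* Main.v *)
Require Import Defs.
From Stdlib Require Import Relations RelationClasses Morphisms.

Local Open Scope apart_scope.

(** Everything is pulled back along [f]: the equality and the apartness of
    [S/ker f] are those of [T] evaluated at [f], so each axiom for them is the
    corresponding axiom of [T], while strong extensionality of [f] brings
    apartness back to [S]. *)

(** The apartness of [T] is extensional, so it may be transported along [f x == f y] and
    [f a == f b]. *)
Lemma coker_ker_apart (S T : semigroup_data) (hT : set_with_apartness T)
  (f : S -> T) (x y a b : S) :
  ker f x y -> ker f a b -> coker f x a -> coker f y b.
Proof. intros e e' H. exact (proj1 (apart_ext hT e e') H). Qed.

(** Multiplicativity of [f] turns the hypothesis into [f x * f z # f y * f t], to which strong
    extensionality of the product in [T] applies. This serves both as co-compatibility and as strong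
    extensionality in the quotient. *)
Lemma coker_mul (S T : semigroup_data) (hT : semigroup_with_apartness T)
  (f : S -> T) (hf : homomorphism f) (x y z t : S) :
  coker f (x * z) (y * t) -> coker f x y \/ coker f z t.
Proof.
  intros H. apply (mul_strong_ext hT).
  exact (proj1 (apart_ext (semigroup_apset hT) (proj2 hf x z)
                          (proj2 hf y t)) H).
Qed.

Lemma coker_co_congruence (S T : semigroup_data)
  (hT : semigroup_with_apartness T) (f : S -> T) (hf : se_homomorphism f) :
  co_congruence (coker f).
Proof.
  destruct hf as [hom se]. pose proof (semigroup_apset hT) as aT. split.
  - intros x y H. now apply (apart_sym aT).
  - intros x y H. now apply se.
  - intros x y H z. now apply (apart_cotrans aT).
  - intros x y z t. now apply coker_mul.
Qed.

Lemma coker_left_associated (S T : semigroup_data)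
  (hT : set_with_apartness T) (f : S -> T) :
  left_associated (coker f) (ker f).
Proof.
  intros x y z [H e]. destruct (apset_eqv_equiv hT).
  refine (coker_ker_apart _ _ hT f _ _ _ _ _ e H).
  apply Equivalence_Reflexive.
Qed.

(** Co-transitivity compares [f a # f b] with [f x]: either [f a # f x], whence [x # a], or
    [f x # f b], which moves along [f x == f y] to [f y # f b], whence [y # b]. *)
Lemma ker_sub_a_complement_coker (S T : semigroup_data)
  (hS : set_with_apartness S) (hT : set_with_apartness T)
  (f : S -> T) (se : strongly_extensional f) :
  inclusion S (ker f) (a_complement (coker f)).
Proof.
  intros x y e a b H. destruct (apset_eqv_equiv hT).
  destruct (apart_cotrans hT H (f x)) as [Hax | Hxb].
  - left. now apply (apart_sym hS), se.
  - right. apply se.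
    apply (coker_ker_apart _ _ hT f x y b b e); [|exact Hxb].
    apply Equivalence_Reflexive.
Qed.

Lemma ker_quotient_semigroup (S T : semigroup_data)
  (hS : semigroup_with_apartness S) (hT : semigroup_with_apartness T)
  (f : S -> T) (hf : homomorphism f) :
  semigroup_with_apartness (ker_quotient f).
Proof.
  pose proof (semigroup_apset hT) as aT.
  pose proof (apset_eqv_equiv aT) as eT.
  split.
  - split.
    + destruct (apset_inhabited (semigroup_apset hS)) as [x].
      exact (inhabits (proj f x)).
    + split.
      * intros x. apply (Equivalence_Reflexive (f (repr x))).
      * intros x y. apply (Equivalence_Symmetric (f (repr x)) (f (repr y))).
      * intros x y z. apply (Equivalence_Transitive (f (repr x)) (f (repr y))).
    + intros x H. exact (apart_irrefl aT H).
    + intros x y H. exact (apart_sym aT H).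
    + intros x z H y. exact (apart_cotrans aT H (f (repr y))).
    + intros x y e a b e'. exact (apart_ext aT e e').
  - intros a a' ea b b' eb.
    change (f (repr a * repr b) == f (repr a' * repr b')).
    transitivity (f (repr a) * f (repr b)); [apply hf|].
    transitivity (f (repr a') * f (repr b')); [|symmetry; apply hf].
    now apply (mul_ext hT).
  (* Representatives already associate in [S] up to [==], and [f] preserves this equality. *)
  - intros x y z. apply (proj1 hf), (mul_assoc hS).
  - intros a b x y. exact (coker_mul _ _ hT f hf _ _ _ _).
Qed.

Lemma induced_embedding (S T : semigroup_data) (f : S -> T)
  (hf : homomorphism f) :
  apartness_embedding (induced f).
Proof.
  (* By definition of the quotient, all conditions but multiplicativity are identity
     implications. *)
  split; [split; [split|]|split]; intros x y; try exact (fun H => H).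
  apply hf.
Qed.

Theorem theorem22 (S T : semigroup_data) (hS : semigroup_with_apartness S)
  (hT : semigroup_with_apartness T) (f : S -> T) (hf : se_homomorphism f) :
  co_congruence (coker f)
  /\ (left_associated (coker f) (ker f)
      /\ inclusion S (ker f) (a_complement (coker f)))
  /\ semigroup_with_apartness (ker_quotient f)
  /\ (apartness_embedding (induced f)
      /\ (forall x : S, f x == induced f (proj f x)))
  /\ (onto f -> apartness_isomorphism (induced f)).
Proof.
  pose proof (semigroup_apset hS) as aS.
  pose proof (semigroup_apset hT) as aT.
  pose proof (induced_embedding S T f (proj1 hf)) as emb.
  split; [|split; [split|split; [|split; [split|]]]].
  - now apply coker_co_congruence.
  - now apply coker_left_associated.
  - apply ker_sub_a_complement_coker; trivial. apply hf.
  - apply ker_quotient_semigroup; trivial. apply hf.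
  - exact emb.
  (* Both sides are convertible, so reflexivity suffices. *)
  - intros x. apply (apset_eqv_equiv aT).
  - intros sur. destruct emb as [se [inj ainj]].
    split; [exact se|split; [split; [exact inj|]|exact ainj]].
    (* The class of a preimage of [t] under [f] is sent to [t]. *)
    intros t. destruct (sur t) as [x e]. now exists (proj f x).
Qed.
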